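(* Let $p\in\sum\mathbb C[\underline x]_d^2$ and let $\varepsilon>0$. Then the $\varepsilon$-ball $\{q\in\mathbb C[\underline x]_{2d}\mid\Vert p-q\Vert_\infty\leqslant\varepsilon\}$ around $p$ with respect to $\Vert\cdot\Vert_\infty$ contains a sum of at most $$\frac{\Vert p\Vert_{\mathfrak m_d,\mathrm{sos}}}{\varepsilon}$$ many Hermitian squares $w^*w$ of elements $w\in\mathbb C[\underline x]_d$.
   Context: $\mathbb C[\underline x]=\mathbb C[x_1,\ldots,x_n]$ is the commutative polynomial algebra with involution $*$ acting by complex conjugation on coefficients (so $x_i^*=x_i$). $\mathbb C[\underline x]_d$ is the subspace of homogeneous polynomials of degree $d$, and $\mathfrak m_d$ is the tuple of all monomials of degree $d$ in $x_1,\ldots,x_n$, which is a basis of $\mathbb C[\underline x]_d$; let $N$ be its length. $\sum\mathbb C[\underline x]_d^2$ is the set of all finite sums $\sum_k w_k^*w_k$ with $w_k\in\mathbb C[\underline x]_d$; the empty sum (zero squares) equals $0$. Homogeneous polynomials are considered as functions on the real unit sphere $S^{n-1}\subseteq\mathbb R^n$, and $\Vert q\Vert_\infty=\sup_{s\in S^{n-1}}\vert q(s)\vert$ for $q\in\mathbb C[\underline x]_{2d}$. With $\mathfrak m_d=(v_1,\ldots,v_N)$, the Gram map is $G_{\mathfrak m_d}\colon\mathrm{Mat}_N(\mathbb C)\to\mathbb C[\underline x]_{2d}$, $G_{\mathfrak m_d}(M)=\sum_{i,j=1}^N m_{ij}v_i^*v_j$, and for $p\in\sum\mathbb C[\underline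 x]_d^2$ the sos-norm is $\Vert p\Vert_{\mathfrak m_d,\mathrm{sos}}=\min\{\mathrm{tr}(M)\mid M\in\mathrm{Psd}_N(\mathbb C),\ G_{\mathfrak m_d}(M)=p\}$, where $\mathrm{Psd}_N(\mathbb C)$ is the cone of (Hermitian) positive semidefinite complex $N\times N$ matrices. *)

(* Defs.v *)
From mathcomp Require Import all_boot all_order all_algebra.
From mathcomp Require Import classical_sets reals.
From mathcomp Require Import complex mpoly.

Set Implicit Arguments.
Unset Strict Implicit.
Unset Printing Implicit Defensive.

Import Order.TTheory GRing.Theory Num.Theory Num.Def.
Local Open Scope ring_scope.
Local Open Scope complex_scope.
Local Open Scope sesquilinear_scope.
Local Open Scope classical_set_scope.

Section SumsOfSquares.
Variables (R : realType) (n : nat).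
Implicit Types (d k : nat) (p q : {mpoly R[i][n]}).

Definition mstar p : {mpoly R[i][n]} := map_mpoly conjC p.

(* The Hermitian squares w i ^* w i are counted with multiplicity, so zero
   terms are allowed and k is an upper bound for the number of squares. *)
Definition is_sum_of_squares d k p : Prop :=
  exists w : 'I_k -> {mpoly R[i][n]},
    (forall i, w i \is d.-homog) /\ p = \sum_(i < k) mstar (w i) * w i.

Definition sos d : set {mpoly R[i][n]} :=
  [set p | exists k, is_sum_of_squares d k p].

Definition sphere : set 'rV[R]_n := [set s | \sum_(i < n) s 0 i ^+ 2 = 1].

Definition supnorm q : R :=
  sup [set ComplexField.Normc.normc q.@[fun i => (s 0 i)%:C] | s in sphere].

Definition sup_ball d p (e : R) : set {mpoly R[i][n]} :=
  [set q | q \is (2 * d).-homog /\ supnorm (p - q) <= e].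

(* 'X_{1..n < d.+1} is the finite type of the exponents of total degree <= d. *)
Definition exponents d : {set 'X_{1..n < d.+1}} :=
  [set m : 'X_{1..n < d.+1} | mdeg (bmnm m) == d]%SET.

Definition nmonom d : nat := #|exponents d|.

Definition monom d (i : 'I_(nmonom d)) : {mpoly R[i][n]} :=
  'X_[bmnm (enum_val i)].

Definition gram d (M : 'M[R[i]]_(nmonom d)) : {mpoly R[i][n]} :=
  \sum_i \sum_j M i j *: (mstar (monom i) * monom j).

(* In the partial order of R[i], 0 <= z says that z is real and nonnegative. *)
Definition psdmx N (M : 'M[R[i]]_N) : Prop :=
  M \is hermsymmx /\ forall x : 'cV[R[i]]_N, 0 <= (x^t* *m M *m x) 0 0.

(* The trace of a Hermitian matrix is real, so taking Re loses nothing. *)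
Definition gram_traces d p : set R :=
  [set complex.Re (\tr M) |
     M in [set M : 'M[R[i]]_(nmonom d) | psdmx M /\ gram M = p]].

(* The least element of gram_traces d p; the default value 0 is returned only
   when there is none, which does not happen for p in sos d: by compactness of
   the set of psd matrices of bounded trace, the minimum is attained. *)
Definition sosnorm d p : R :=
  xget 0 (gram_traces d p `&` lbound (gram_traces d p)).

End SumsOfSquares.

(* Main.v *)
(* Compactness gives a positive semidefinite Gram matrix M of p of least trace.
   Let M = sum_k l_k u_k u_k^* be its spectral decomposition and let q be the
   polynomial with Gram matrix sum_(l_k > e) l_k u_k u_k^*.  At most tr M / e
   eigenvalues exceed e, and the dropped part has operator norm at most e.  On
   the sphere the vector of monomials of degree d has norm at most 1, because
   the multinomial coefficients in (x_1^2 + ... + x_n^2)^d are at least 1;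
   hence |p - q| <= e there. *)
From HB Require Import structures.
Require Import Defs.
From mathcomp Require Import all_boot all_order all_algebra.
From mathcomp Require Import classical_sets reals.
From mathcomp Require Import complex mpoly.
From mathcomp Require Import boolp topology normedtype derive.

Set Implicit Arguments.
Unset Strict Implicit.
Unset Printing Implicit Defensive.

Import Order.TTheory GRing.Theory Num.Theory Num.Def numFieldNormedType.Exports.
Local Open Scope ring_scope.
Local Open Scope complex_scope.
Local Open Scope sesquilinear_scope.
Local Open Scope classical_set_scope.

(** * Closedness of linear conditions and of the psd cone, in real coordinates *)

Section ClosedPsd.
Variable R : realType.

Lemma scalar_continuous K (f : 'rV[R]_K -> R) : scalar f -> continuous f.
Proof.
move=> flin.
have fE u : f u = \sum_(i < K) u 0 i * f (delta_mx 0 i).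
  pose g : {scalar 'rV[R]_K} := HB.pack f (GRing.isLinear.Build _ _ _ _ f flin).
  rewrite -[f u]/(g u) [u in LHS]row_sum_delta linear_sum.
  by apply: eq_bigr => i _; rewrite linearZ.
rewrite (funext fE).
apply: (@continuous_big R^o) => [|i _ u]; first exact: add_continuous.
have c : {for u, continuous (fun v : 'rV[R]_K => v 0 i)}.
  exact: coord_continuous.
exact: (@cvgM R _ _ (nbhs_filter u) _ _ _ _ c (cvg_cst (f (delta_mx 0 i)))).
Qed.

Lemma closed_scalar_preimage K (f : 'rV[R]_K -> R) (D : set R) :
  scalar f -> closed D -> closed [set u | D (f u)].
Proof. by move=> /scalar_continuous/continuous_closedP; exact. Qed.

(* Real coordinates on the complex matrices, so that compactness can be taken
   from row vectors over R. *)
Definition complex_mx N (u : 'rV[R]_(N * N + N * N)) : 'M[R[i]]_N :=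
  \matrix_(i, j) (vec_mx (lsubmx u) i j +i* vec_mx (rsubmx u) i j).

(** Only real scalars are allowed, because the Hermitian condition involves conjugation, which is
    not complex linear. *)
Definition real_linear N (phi : 'M[R[i]]_N -> R[i]) : Prop :=
  forall (a : R) (X Y : 'M_N), phi (a%:C *: X + Y) = a%:C * phi X + phi Y.

Lemma complex_mx_surj N (X : 'M[R[i]]_N) : exists u, complex_mx u = X.
Proof.
exists (row_mx (mxvec (map_mx (@complex.Re R) X))
               (mxvec (map_mx (@complex.Im R) X))).
apply/matrixP => i j.
by rewrite mxE row_mxKl row_mxKr !mxvecK !mxE; case: (X i j).
Qed.

Lemma complex_mx_linear N a (u v : 'rV[R]_(N * N + N * N)) :
  complex_mx (a *: u + v) = a%:C *: complex_mx u + complex_mx v.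
Proof.
apply/matrixP => i j; rewrite !mxE.
by apply/eqP; rewrite eq_complex /= !mul0r subr0 addr0 !eqxx.
Qed.

Section RealLinear.
Variables (N : nat) (phi : 'M[R[i]]_N -> R[i]).
Hypothesis phiP : real_linear phi.

Lemma Re_scalar : scalar (fun u => complex.Re (phi (complex_mx u))).
Proof.
move=> a u v; rewrite complex_mx_linear phiP.
by case: (phi _) => ? ?; case: (phi _) => ? ? /=; rewrite mul0r subr0.
Qed.

Lemma Im_scalar : scalar (fun u => complex.Im (phi (complex_mx u))).
Proof.
move=> a u v; rewrite complex_mx_linear phiP.
by case: (phi _) => ? ?; case: (phi _) => ? ? /=; rewrite mul0r addr0.
Qed.

Lemma closed_real_linear_eq (c : R[i]) :
  closed [set u | phi (complex_mx u) = c].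
Proof.
rewrite (_ : [set _ | _] =
    [set u | complex.Re (phi (complex_mx u)) = complex.Re c] `&`
    [set u | complex.Im (phi (complex_mx u)) = complex.Im c]).
  apply: closedI.
    exact: (@closed_scalar_preimage _ _ [set x | x = complex.Re c]
      Re_scalar (@closed_eq R _)).
  exact: (@closed_scalar_preimage _ _ [set x | x = complex.Im c]
      Im_scalar (@closed_eq R _)).
apply/seteqP; split => [u /= ->//|u /= []].
by case: (phi _) => ? ?; case: c => ? ? /= -> ->.
Qed.

Lemma closed_real_linear_ge0 : closed [set u | 0 <= phi (complex_mx u)].
Proof.
rewrite (_ : [set _ | _] =
    [set u | complex.Im (phi (complex_mx u)) = 0] `&`
    [set u | 0 <= complex.Re (phi (complex_mx u))]).
  apply: closedI.
    exact: (@closed_scalar_preimage _ _ [set x | x = 0]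
      Im_scalar (@closed_eq R 0)).
  exact: (@closed_scalar_preimage _ _ [set x | 0 <= x]
      Re_scalar (@closed_ge R 0)).
apply/seteqP; split => [u /=|u /= [im0 re0]]; rewrite lecE /=.
  by case/andP => /eqP.
by rewrite im0 eqxx.
Qed.

End RealLinear.

(** The cone is an intersection of closed conditions, each real linear in the matrix: an equation
    for every pair of indices and an inequality for every test vector [x]. *)
Lemma closed_psdmx N : closed [set u | psdmx (@complex_mx N u)].
Proof.
rewrite (_ : [set _ | _] =
    (\bigcap_(ij in [set: 'I_N * 'I_N])
      [set u | complex_mx u ij.1 ij.2 - conjC (complex_mx u ij.2 ij.1) = 0]) `&`
    \bigcap_(x in [set: 'cV[R[i]]_N])
      [set u | 0 <= (x^t* *m complex_mx u *m x) 0 0]).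
  apply: closedI.
    apply: closed_bigI => -[i j] _ /=.
    apply: (@closed_real_linear_eq N (fun X => X i j - conjC (X j i))) => a X Y.
    have aE : conjC a%:C = a%:C := conjc_real a.
    by rewrite !mxE rmorphD rmorphM /= aE mulrBr opprD addrACA.
  apply: closed_bigI => x _.
  apply: (@closed_real_linear_ge0 N (fun X => (x^t* *m X *m x) 0 0)) => a X Y.
  by rewrite mulmxDr mulmxDl -scalemxAr -scalemxAl !mxE.
apply/seteqP; split => u /=.
  case=> uh upsd; split => [[i j] _|x _] //=.
  have /matrixP/(_ i j) := is_hermitianmxP _ _ _ uh.
  by rewrite expr0 scale1r => e; rewrite [X in X - _]e !mxE subrr.
case=> uh upsd; split=> [|x]; last exact: upsd.
apply/is_hermitianmxP; rewrite expr0 scale1r; apply/matrixP => i j.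
by have /= /eqP := uh (i, j) I; rewrite subr_eq0 => /eqP ->; rewrite !mxE.
Qed.

End ClosedPsd.

(** * Spectral decomposition and entry bounds of psd matrices *)

Section Psd.
Variable R : realType.

Lemma psdmx_gram m N (A : 'M[R[i]]_(m, N)) : psdmx (A^t* *m A).
Proof.
split=> [|x].
  by apply/is_hermitianmxP; rewrite expr0 scale1r trmx_mul map_mxM trmxCK.
rewrite mulmxA -mulmxA -map_mxM -trmx_mul mxE.
by apply: sumr_ge0 => i _; rewrite !mxE mulrC mul_conjC_ge0.
Qed.

Lemma psdmx_spectral N (M : 'M[R[i]]_N) : psdmx M ->
  exists (P : 'M_N) (l : 'I_N -> R), [/\ P \is unitarymx, forall k, 0 <= l k &
    M = P^t* *m diag_mx (\row_k (l k)%:C) *m P].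
Proof.
move=> [Mh Mpsd]; set P := spectralmx M.
have Pu : P \is unitarymx := spectral_unitarymx M.
have := hermitian_normalmx Mh => /orthomx_spectralP.
rewrite invmx_unitary // -/P => ME.
have d_ge0 k : 0 <= spectral_diag M 0 k.
  (* At the eigenvector [P^t* *m delta_mx k 0] the quadratic form of [M] takes the [k]-th eigenvalue
     as its value. *)
  have := Mpsd (P^t* *m delta_mx k 0); rewrite {1}ME.
  rewrite trmx_mul map_mxM trmxCK trmx_delta map_delta_mx !mulmxA mulmxtVK //.
  rewrite -(mulmxA _ P) (unitarymxP Pu) mulmx1.
  by rewrite -rowE -colE !mxE eqxx mulr1n.
exists P, (fun k => complex.Re (spectral_diag M 0 k)); split=> //.
  by move=> k; move: (d_ge0 k); rewrite lecE => /andP[].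
apply: etrans ME _; congr (_ *m diag_mx _ *m _); apply/rowP => k; rewrite mxE.
by rewrite RRe_real // ger0_real.
Qed.

Lemma mxtrace_unitary_diag N (P : 'M[R[i]]_N) (l : 'I_N -> R) :
  P \is unitarymx ->
  \tr (P^t* *m diag_mx (\row_k (l k)%:C) *m P) = (\sum_k l k)%:C.
Proof.
move=> Pu; rewrite mxtrace_mulC mulmxA (unitarymxP Pu) mul1mx mxtrace_diag.
by rewrite rmorph_sum; apply: eq_bigr => k _; rewrite mxE.
Qed.

Lemma conj_diag_mxE m N (A : 'M[R[i]]_(m, N)) (d : 'rV_m) i j :
  (A^t* *m diag_mx d *m A) i j = \sum_k d 0 k * (conjC (A k i) * A k j).
Proof.
rewrite mul_mx_diag mxE; apply: eq_bigr => k _.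
by rewrite !mxE mulrA [d 0 k * _]mulrC.
Qed.

Lemma unitarymx_le1 N (P : 'M[R[i]]_N) i j : P \is unitarymx -> `|P i j| <= 1.
Proof.
move=> /unitarymxP/matrixP/(_ i i); rewrite [RHS]mxE eqxx mxE => /= PE.
rewrite -(expr_le1 (n := 2)) // -[leRHS]PE (bigD1 j) //= !mxE normCK lerDl.
by apply: sumr_ge0 => k _; rewrite !mxE mul_conjC_ge0.
Qed.

(** In the spectral decomposition an entry is a sum of eigenvalues weighted by products of two
    entries of a unitary matrix, so by weights of modulus at most 1. This bounds a psd matrix by its
    trace. *)
Lemma psdmx_entry_le N (M : 'M[R[i]]_N) i j : psdmx M -> `|M i j| <= \tr M.
Proof.
move=> /psdmx_spectral[P [l [Pu l_ge0 ->]]].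
rewrite mxtrace_unitary_diag // conj_diag_mxE rmorph_sum.
apply: (le_trans (ler_norm_sum _ _ _)); apply: ler_sum => k _.
rewrite mxE normrM ger0_norm ?ler0c // ler_piMr ?ler0c //.
rewrite normrM norm_conjC.
by rewrite mulr_ile1 // unitarymx_le1.
Qed.

End Psd.

(** * Comparison of the sum of all monomials with a power of the sum of the variables *)

Section Monomials.
Variable n : nat.

(** The word [f] of [d] variables selects one term in the expansion of a [d]-th power. Induction on
    [d] removes one variable that occurs in [m]. *)
Lemma mnm_sum_units d (m : 'X_{1..n}) : mdeg m = d ->
  exists f : {ffun 'I_d -> 'I_n}, (\sum_k U_(f k))%MM = m.
Proof.
elim: d m => [|d IHd] m dm.
  have /eqP -> : m == 0%MM by rewrite -mdeg_eq0 dm.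
  by exists (ffun0 (card_ord 0)); rewrite big_ord0.
have [j mj] : exists j, (0 < m j)%N.
  apply/existsP; apply: contra_eqT dm; rewrite negb_exists => /forallP m0.
  rewrite mdegE big1 // => i _; apply/eqP; rewrite -leqn0 leqNgt; exact: m0.
have le_jm : (U_(j) <= m)%MM by rewrite lep1mP -lt0n.
have [|f fE] := IHd (m - U_(j))%MM.
  by apply: succn_inj; rewrite -dm -[in RHS](submK le_jm) mdegD mdeg1 addn1.
exists [ffun k => oapp f j (unlift ord0 k)].
rewrite big_ord_recl ffunE unlift_none /=.
under eq_bigr do rewrite ffunE liftK /=.
by rewrite fE addmC submK.
Qed.

(** The power expands into a sum over all words [h] of length [d]. Distinct monomials come from
    distinct words, and the terms of the remaining words are nonnegative; so no multinomial
    coefficient has to be computed. *)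
Lemma sum_monomials_le (R : realDomainType) d (y : 'I_n -> R) :
  (forall j, 0 <= y j) ->
  \sum_(i < nmonom n d) 'X_[bmnm (enum_val i)].@[y] <= (\sum_j y j) ^+ d.
Proof.
move=> y_ge0.
have /fin_all_exists[f fE] (i : 'I_(nmonom n d)) :
    exists f : {ffun 'I_d -> 'I_n}, (\sum_k U_(f k))%MM = bmnm (enum_val i).
  by apply: mnm_sum_units; apply/eqP; have := enum_valP i; rewrite inE.
have f_inj : injective f.
  by move=> i i' eq_f; apply/enum_val_inj/val_inj; rewrite /= -!fE eq_f.
pose g (h : {ffun 'I_d -> 'I_n}) := \prod_k y (h k).
have -> : (\sum_j y j) ^+ d = \sum_h g h.
  by rewrite /g -(bigA_distr_bigA (fun _ j => y j)) prodr_const card_ord.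
rewrite (eq_bigr (fun i => g (f i))) => [|i _]; last first.
  rewrite -fE -(big_map (fun k => U_(f i k)%MM) xpredT id) -mpolyX_prod big_map.
  rewrite rmorph_prod; apply: eq_bigr => k _; exact: mevalXU.
rewrite -(big_imset g (in2W f_inj)) /=.
rewrite [leRHS](bigID (mem (f @: 'I_(nmonom n d)))) /=.
by rewrite lerDl sumr_ge0 // => h _; apply: prodr_ge0.
Qed.

End Monomials.

(** * Gram matrices, attainment of the minimal trace, and estimates on the sphere *)

Section Gram.
Variables (R : realType) (n d : nat).
Local Notation N := (nmonom n d).
Local Notation C := R[i].

Definition lincomb (a : 'rV[C]_N) : {mpoly C[n]} := \sum_j a 0 j *: monom R j.

Lemma monom_homog j : @monom R n d j \is d.-homog.
Proof. by rewrite dhomogX; have := enum_valP j; rewrite inE. Qed.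

Lemma lincomb_homog a : lincomb a \is d.-homog.
Proof. by apply: rpred_sum => j _; apply/rpredZ/monom_homog. Qed.

Lemma homog_lincomb (w : {mpoly C[n]}) : w \is d.-homog ->
  exists a, w = lincomb a.
Proof.
move=> wh; exists (\row_j w@_(bmnm (enum_val j))).
(* [msize] is the degree plus one; this bound lets [mpolywE] expand [w] over a finite type of
   exponents, where those of degree other than [d] contribute zero. *)
have sz_w : (msize w <= d.+1)%N.
  rewrite msizeE; apply/bigmax_leqP_seq => m mw _.
  by rewrite (dhomog_mf wh).
rewrite [LHS](mpolywE sz_w) (bigID (mem (exponents n d))) /= [X in _ + X]big1.
  rewrite addr0 big_enum_val; apply: eq_bigr => j _; by rewrite mxE.
by move=> m; rewrite inE => md; rewrite (dhomog_nemf_coeff wh) ?scale0r.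
Qed.

Lemma mstar_sum I (r : seq I) (F : I -> {mpoly C[n]}) :
  mstar (\sum_(i <- r) F i) = \sum_(i <- r) mstar (F i).
Proof. exact: rmorph_sum. Qed.

Lemma mstarZ c (p : {mpoly C[n]}) : mstar (c *: p) = conjC c *: mstar p.
Proof. exact: map_mpolyZ. Qed.

Lemma mstar_homog e (p : {mpoly C[n]}) : p \is e.-homog -> mstar p \is e.-homog.
Proof.
move=> /dhomogP ph; apply/dhomogP => m; rewrite mcoeff_msupp mcoeff_map_mpoly.
by rewrite conjC_eq0 -mcoeff_msupp => /ph.
Qed.

(** The bridge between matrices and squares: with all weights 1 it yields a Gram matrix for a sum of
    squares, and with [A] unitary it turns a spectral decomposition into weighted squares. *)
Lemma gram_conj_diag m (A : 'M[C]_(m, N)) (l : 'rV[C]_m) :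
  gram (A^t* *m diag_mx l *m A) =
  \sum_k l 0 k *: (mstar (lincomb (row k A)) * lincomb (row k A)).
Proof.
rewrite /gram.
transitivity (\sum_i \sum_j \sum_k l 0 k *:
    (conjC (A k i) *: (A k j *: (mstar (@monom R n d i) * monom R j)))).
  apply: eq_bigr => i _; apply: eq_bigr => j _.
  by rewrite conj_diag_mxE scaler_suml; apply: eq_bigr => k _;
    rewrite !scalerA mulrA.
under eq_bigr do rewrite exchange_big /=; rewrite exchange_big /=.
apply: eq_bigr => k _; rewrite mstar_sum big_distrlr /= scaler_sumr.
apply: eq_bigr => i _; rewrite scaler_sumr; apply: eq_bigr => j _.
by rewrite !mxE mstarZ -scalerAl -scalerAr.
Qed.

Lemma sos_gram (p : {mpoly C[n]}) : sos d p ->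
  exists M : 'M[C]_N, psdmx M /\ gram M = p.
Proof.
move=> [m [w [wh ->]]].
have /fin_all_exists[a wE] i := homog_lincomb (wh i).
pose A := \matrix_i a i; exists (A^t* *m A); split; first exact: psdmx_gram.
rewrite -[A^t*]mulmx1 -diag_const_mx gram_conj_diag.
by apply: eq_bigr => k _; rewrite mxE scale1r rowK -wE.
Qed.

Lemma gram_linear a (X Y : 'M[C]_N) : gram (a *: X + Y) = a *: gram X + gram Y.
Proof.
rewrite /gram scaler_sumr -big_split; apply: eq_bigr => i _ /=.
rewrite scaler_sumr -big_split; apply: eq_bigr => j _ /=.
by rewrite !mxE scalerDl scalerA.
Qed.

Lemma closed_gram (p : {mpoly C[n]}) :
  closed [set u | gram (complex_mx u : 'M[C]_N) = p].
Proof.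
rewrite (_ : [set _ | _] = \bigcap_(m in setT)
    [set u | (gram (complex_mx u : 'M[C]_N))@_m = p@_m]).
  apply: closed_bigI => m _.
  apply: (@closed_real_linear_eq R N (fun X => (gram X)@_m)) => a X Y.
  by rewrite gram_linear mcoeffD mcoeffZ.
apply/seteqP; split => [u uE m _ /=|u uE]; first by rewrite uE.
by apply/mpolyP => m; exact: (uE m).
Qed.

Lemma bounded_trace_psdmx K (t : R) :
  bounded_set [set u | psdmx (@complex_mx R K u) /\
    complex.Re (\tr (complex_mx u)) <= t].
Proof.
exists `|t|; split => [|x]; first exact: normr_real.
move=> /(le_lt_trans (ler_norm t)) tx u /= [upsd ut].
have Re_bound (z : C) : `|z| <= \tr (complex_mx u) -> `|complex.Re z| <= x.
  move=> /(le_trans (normc_ge_Re z)); rewrite lecE => /andP[_ /=].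
  by move=> /le_trans/(_ ut)/le_trans; apply; exact: ltW.
rewrite [leLHS]/normr /= mx_normrE; apply/bigmax_leP; split.
  (* The maximum that defines the norm starts from 0, so [0 <= x] comes first; it follows from the
     nonnegativity of the trace. *)
  have [P [l [Pu l_ge0 uE]]] := psdmx_spectral upsd.
  apply: le_trans (normr_ge0 _) (Re_bound 0 _).
  by rewrite normr0 uE mxtrace_unitary_diag // ler0c sumr_ge0.
(* Multiplication by the imaginary unit keeps the modulus and reduces this to the bound on real
   parts. *)
have Im_bound (z : C) : `|z| <= \tr (complex_mx u) -> `|complex.Im z| <= x.
  move=> zt; rewrite -[complex.Im z]opprK -ReiNIm normrN Re_bound // normrM.
  rewrite (_ : `|'i%C| = 1) ?mulr1 //.
  by rewrite normc_def /= expr0n expr1n add0r sqrtr1.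
move=> [i0 k] _ /=; rewrite ord1.
case: (split_ordP k) => k' ->; case/mxvec_indexP: k' => i j.
  rewrite (_ : u 0 _ = complex.Re (complex_mx u i j)); last by rewrite !mxE.
  by apply/Re_bound/psdmx_entry_le.
rewrite (_ : u 0 _ = complex.Im (complex_mx u i j)); last by rewrite !mxE.
by apply/Im_bound/psdmx_entry_le.
Qed.

(** The Gram matrices of [p] are cut off at the trace [t] of one of them, [M0]. What is left is
    nonempty and compact, so the trace attains its minimum there. *)
Lemma gram_traces_min (p : {mpoly C[n]}) : sos d p ->
  exists r, (gram_traces d p `&` lbound (gram_traces d p)) r.
Proof.
move=> /sos_gram[M0 [M0psd M0p]]; pose t := complex.Re (\tr M0).
pose tr u := complex.Re (\tr (@complex_mx R N u)).
have tr_scalar : scalar tr.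
  by apply: (@Re_scalar R N (fun X => \tr X)) => a X Y;
    rewrite mxtraceD mxtraceZ.
pose A := [set u | psdmx (@complex_mx R N u)] `&` [set u | tr u <= t] `&`
  [set u | gram (@complex_mx R N u) = p].
have Acpt : compact A.
  apply: bounded_closed_compact.
    have [K [Kr bK]] := @bounded_trace_psdmx N t; exists K.
    split=> // x /bK b u [uA _].
    exact: b uA.
  apply: closedI; last exact: closed_gram.
  apply: closedI; first exact: closed_psdmx.
  exact: (@closed_scalar_preimage _ _ _ [set x | x <= t]
    tr_scalar (@closed_le R t)).
have [u0 u0M] := complex_mx_surj M0.
have A0 : A !=set0 by exists u0; rewrite /A /tr /= u0M.
have [|u uA umin] := @EVT_min_rV _ _ tr A A0 Acpt.
  by apply/continuous_subspaceT/scalar_continuous.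
move: uA; rewrite inE => -[[upsd ut] up].
exists (tr u); split; first by exists (complex_mx u).
move=> _ [M [Mpsd Mp] <-]; have [v vM] := complex_mx_surj M.
(* A Gram matrix outside the cutoff has trace at least [t], hence cannot beat the minimum. *)
have [le_tM|/ltW le_Mt] := lerP t (complex.Re (\tr M)).
  exact: le_trans ut _.
by rewrite -vM; apply: umin; rewrite inE /A /tr /= vM.
Qed.

Lemma supnorm_le (q : {mpoly C[n]}) (e : R) : 0 <= e ->
  (forall s, sphere s -> `|q.@[fun i => (s 0 i)%:C]| <= e%:C) -> supnorm q <= e.
Proof.
move=> e_ge0 qe; rewrite /supnorm.
set S := [set _ | _ in _].
(* The supremum of the empty set is 0 by convention; [0 <= e] covers this case. *)
have [->|/set0P S0] := eqVneq S set0; first by rewrite sup0.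
apply: ge_sup => // _ [s ss <-].
by rewrite -lecR; exact: qe.
Qed.

Lemma sum_monom_sphere (s : 'rV[R]_n) : sphere s ->
  \sum_j `|(@monom R n d j).@[fun i => (s 0 i)%:C]| ^+ 2 <= 1.
Proof.
move=> sE.
(* The squared modulus of a monomial at [s] is the same monomial at the squared coordinates, which
   sum to 1. *)
have := @sum_monomials_le n R d (fun j => s 0 j ^+ 2) (fun j => sqr_ge0 _).
rewrite sE expr1n -lecR rmorph_sum; apply: le_trans; apply: ler_sum => j _.
rewrite !mevalX normr_prod -prodrXl rmorph_prod ler_prod // => i _.
rewrite exprn_ge0 //= normrX -exprM mulnC exprM.
by rewrite real_normK ?complex_real ?eqxx // !rmorphXn.
Qed.

Lemma mstar_eval (p : {mpoly C[n]}) (s : 'I_n -> R) :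
  (mstar p).@[fun i => (s i)%:C] = conjC p.@[fun i => (s i)%:C].
Proof.
rewrite [p in LHS]mpolyE mstar_sum raddf_sum [in RHS]mevalE [in RHS]rmorph_sum.
apply: eq_bigr => m _ /=.
rewrite mstarZ [mstar _]map_mpolyX mevalZ mevalX rmorphM rmorph_prod.
congr (_ * _); apply: eq_bigr => i _; rewrite rmorphXn; congr (_ ^+ _).
by rewrite [RHS]conjc_real.
Qed.

(** The values at [s] are the entries of [P *m v], with [v] the vector of monomials at [s]; a
    unitary matrix preserves the norm of [v]. *)
Lemma sum_lincomb_unitary (P : 'M[C]_N) (s : 'rV[R]_n) :
  P \is unitarymx -> sphere s ->
  \sum_k `|(lincomb (row k P)).@[fun i => (s 0 i)%:C]| ^+ 2 <= 1.
Proof.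
move=> Pu /sum_monom_sphere; apply: le_trans.
pose v : 'cV[C]_N := \col_j (@monom R n d j).@[fun i => (s 0 i)%:C].
have vE m (x : 'cV[C]_m) : (x^t* *m x) 0 0 = \sum_k `|x k 0| ^+ 2.
  by rewrite mxE; apply: eq_bigr => k _; rewrite !mxE normCK mulrC.
have := vE _ (P *m v); rewrite trmx_mul map_mxM mulmxA.
rewrite -(mulmxA (v^t*)) (mulmx1C (unitarymxP Pu)) mulmx1 vE => vPv.
rewrite (eq_bigr (fun k => `|(P *m v) k 0| ^+ 2)) => [|k _]; last first.
  congr (`|_| ^+ 2); rewrite raddf_sum mxE; apply: eq_bigr => j _.
  by rewrite /= mevalZ !mxE.
by rewrite -vPv; under eq_bigr do rewrite mxE.
Qed.

End Gram.

Theorem theorem10 (R : realType) (n d : nat) (hn : (0 < n)%N)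
    (p : {mpoly R[i][n]}) (hp : sos d p) (e : R) (he : 0 < e) :
  exists q : {mpoly R[i][n]}, sup_ball d p e q /\
    exists k : nat, k%:R <= sosnorm d p / e /\ is_sum_of_squares d k q.
Proof.
(* Since the minimum is attained, [sosnorm] is not the default value but the trace of an actual Gram
   matrix [M]. *)
have [[M [Mpsd Mp] trM] _] := xgetPex 0 (gram_traces_min hp).
have [P [l [Pu l_ge0 ME]]] := psdmx_spectral Mpsd.
have {trM} normE : sosnorm d p = \sum_k l k.
  by rewrite [LHS](esym trM) ME mxtrace_unitary_diag.
pose big := [set k | e < l k]%SET.
pose sq k := mstar (lincomb (row k P)) * lincomb (row k P).
have pE : p = \sum_k (l k)%:C *: sq k.
  by rewrite -Mp ME gram_conj_diag; apply: eq_bigr => k _; rewrite mxE.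
exists (\sum_(k in big) (l k)%:C *: sq k); split; first split.
- apply: rpred_sum => k _; apply: rpredZ; rewrite mul2n -addnn.
  by apply: dhomogM; first apply: mstar_homog; exact: lincomb_homog.
- rewrite pE (bigID (mem big)) /= addrAC subrr add0r.
  apply: supnorm_le (ltW he) _ => s s1; rewrite raddf_sum /=.
  apply: le_trans (ler_norm_sum _ _ _) _.
  pose v k := (lincomb (row k P)).@[fun i => (s 0 i)%:C].
  (* At a real point [sq k] has the value [|v k| ^+ 2], and each dropped weight is at most [e]; the
     indices in [big] only enlarge the right-hand side. *)
  apply: (@le_trans _ _ (e%:C * \sum_k `|v k| ^+ 2)); last first.
    by rewrite ler_piMr ?ler0c ?(ltW he) // sum_lincomb_unitary.
  rewrite mulr_sumr [leLHS]big_mkcond /=; apply: ler_sum => k _.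
  case: ifPn => [|_]; last by rewrite mulr_ge0 ?exprn_ge0 // ler0c ltW.
  rewrite inE -leNgt => lke.
  rewrite mevalZ mevalM mstar_eval normrM normrM norm_conjC -expr2.
  by rewrite ger0_norm ?ler0c // ler_wpM2r ?exprn_ge0 // lecR.
- exists #|big|; split.
    (* Each of the [#|big|] kept eigenvalues exceeds [e], and the others are nonnegative, so [e]
       times the count is at most the trace. *)
    rewrite ler_pdivlMr // normE (bigID (mem big)) /=.
    rewrite ler_wpDr ?sumr_ge0 //.
    rewrite -sumr_const mulr_suml; apply: ler_sum => k.
    by rewrite inE mul1r => /ltW.
  (* The nonnegative weight is absorbed into the square through its real square root, which
     conjugation fixes. *)
  exists (fun i => (Num.sqrt (l (enum_val i)))%:C *:
    lincomb (row (enum_val i) P)).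
  split=> [i|]; first exact/rpredZ/lincomb_homog.
  rewrite big_enum_val; apply: eq_bigr => i _.
  rewrite mstarZ -scalerAl -scalerAr scalerA [conjC _]conjc_real.
  by rewrite -rmorphM -expr2 sqr_sqrtr.
Qed.
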